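(* Let $K$ be a field, $F$ a tract, and $\varphi:K\to F$ an epic homomorphism of tracts. Then for every $m\times n$ matrix $A$ over $F$, $r_{\mathrm{mat}}(\varphi^{-1}(A)) = r_{\varphi\text{-}\mathrm{mat}}(A)$; that is, the minimum rank of a matrix $A'$ over $K$ with $\varphi(A')=A$ equals the minimal rank of a $K$-matroid $M$ on $[n]$ such that every row of $A$ is a covector of $\varphi_*(M)$.
   Context: A tract is a multiplicatively written commutative monoid $F$ with an absorbing element $0$ such that $F^\times = F\setminus\{0\}$ is a group, together with a subset $N_F$ (the null set) of the group semiring $\mathbb{N}[F^\times]$, such that: the zero element of $\mathbb{N}[F^\times]$ lies in $N_F$; there is a unique $\epsilon\in F^\times$ with $1+\epsilon\in N_F$; and $N_F$ is closed under multiplication by $F^\times$. Formal sums with zero terms are read with zero terms discarded. A field $K$ is a tract with $N_K$ the formal sums whose sum in $K$ is $0$. A homomorphism of tracts $\varphi:F'\to F$ satisfies $\varphi(0)=0$, restricts to a group homomorphism $(F')^\times\to F^\times$, and $\varphi(N_{F'})\subseteq N_F$; it acts on vectors and matrices entrywise. $X,Y\in F^n$ are orthogonal if $\sum_iX_iY_i\in N_F$. An $F$-matroid $M$ of rank $r$ on $[n]$ is a matroid $\underline{M}$ of rank $r$ on $[n]$ with subsets $\mathcal{C}(M),\mathcal{C}^*(M)\subseteq F^n$ ($F$-circuits, $F$-cocircuits) such that: both are closed under multiplication by $F^\times$; supports of $F$-circuits (resp. $F$-cocircuits) are circuits (resp. cocircuits) of $\underline{M}$; each circuit (resp. cocircuit)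 of $\underline{M}$ is the support of an $F$-circuit (resp. $F$-cocircuit), unique up to $F^\times$-scaling; and every $F$-circuit is orthogonal to every $F$-cocircuit. The vectors of $M$ are the $X\in F^n$ orthogonal to all $F$-cocircuits; the covectors are the $X\in F^n$ orthogonal to all $F$-circuits. (For $F=K$ a field, a $K$-matroid of rank $r$ is the same as an $r$-dimensional subspace of $K^n$, its covectors being the elements of that subspace.) The push-forward $\varphi_*(M')$ of an $F'$-matroid $M'$ has the same underlying matroid, with $F$-circuits (resp. $F$-cocircuits) the vectors $c\varphi(X)$, $X$ an $F'$-circuit (resp. $F'$-cocircuit) of $M'$, $c\in F^\times$. $\varphi:F'\to F$ is epic if for every $F'$-matroid $M'$ the map $X\mapsto\varphi(X)$ from vectors of $M'$ to vectors of $\varphi_*(M')$ is surjective. The matroidal rank of a matrix over a tract is the minimal rank of a matroid over that tract on $[n]$ having all rows as covectors (for matrices over a field, this is the usual rank). $r_{\varphi\text{-}\mathrm{mat}}(A)$ is the minimal rank of an $F'$-matroid $M'$ with every row of $A$ a covector of $\varphi_*(M')$; $r_{\mathrm{mat}}(\varphi^{-1}(A))$ is the minimal matroidal rank of a matrix $A'$ over $F'$ with $\varphi(A')=A$, or $+\infty$ if none exists. *)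

(* Defs.v *)
From HB Require Import structures.
From mathcomp Require Import all_boot all_fingroup all_algebra.
From mathcomp Require Import finmap multiset.
From mathcomp Require Import boolp.

Set Implicit Arguments.
Unset Strict Implicit.
Unset Printing Implicit Defensive.

Local Open Scope mset_scope.
Local Open Scope group_scope.

(* The underlying monoid is a [monoidType] (written multiplicatively, in
   [group_scope]); [tone_neq0] and [tmulV] say that the nonzero elements form
   a group.  An element of the group semiring N[F^x] is a finite multiset of
   nonzero elements of F, its addition being the sum of multisets; [tnull] is
   the membership predicate of the null set, and [tnull_unit] states that the
   null set is contained in N[F^x]. *)
HB.mixin Record Monoid_isTract F of Monoid F := {
  tzero : F;
  tmulC : commutative (fun x y : F => x * y);
  tmul0 : forall x : F, tzero * x = tzero;
  tone_neq0 : (1 : F) != tzero;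
  tmulV : forall x : F, x != tzero -> exists y : F, y * x = 1;
  tnull : {mset F} -> Prop;
  tnull_unit : forall u : {mset F}, tnull u -> tzero \notin u;
  tnull0 : tnull mset0;
  tnull_eps : exists! e : F, e != tzero /\ tnull [mset (1 : F); e];
  tnullM : forall (a : F) (u : {mset F}), a != tzero -> tnull u ->
    tnull (seq_mset [seq a * x | x <- u]) }.

#[short(type="tractType")]
HB.structure Definition Tract := {F of Monoid_isTract F & Monoid F}.

Arguments tzero {s}.
Arguments tmulV {s} [x].
Arguments tnullM {s} [a u].

(* The formal sum of a family of elements of F: zero terms are discarded. *)
Definition formal_sum (F : tractType) (s : seq F) : {mset F} :=
  seq_mset [seq x <- s | x != tzero].

(* [thom_neq0], [thomM] and [thom0] say that 0 goes to 0 and that the map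
   restricts to a group homomorphism from (F')^x to F^x. *)
Record tract_hom (F' F : tractType) := TractHom {
  thom :> F' -> F;
  thom0 : thom tzero = tzero;
  thom_neq0 : forall x, x != tzero -> thom x != tzero;
  thomM : forall x y, x != tzero -> y != tzero ->
    thom (x * y) = thom x * thom y;
  thom_null : forall u : {mset F'}, tnull u ->
    tnull (seq_mset [seq thom x | x <- u]) }.

(* A field as a tract: an alias of the carrier, so that the multiplicative
   monoid of K does not interfere with its ring structure. *)
Definition field_tract (K : fieldType) : Type := K.

Section FieldTract.
Variable K : fieldType.

Definition field_null (s : {mset K}) : Prop :=
  (0%R \notin s) /\ (\sum_(x <- s) x = 0)%R.

Lemma field_null_eps :
  exists! e : K, e != 0%R /\ field_null [mset (1%R : K); e].
Proof.
have sum2 e : (\sum_(x <- [mset (1%R : K); e]) x = 1 + e)%R.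
  rewrite (perm_big [:: 1%R; e]) /=; first by rewrite !big_cons big_nil GRing.addr0.
  apply/allP => x _ /=; rewrite count_mem_mset mset1DE msetnE !(eq_sym x).
  by rewrite addn0; case: (e == x).
exists (-1)%R; split=> [|e [_ [_]]].
  split; first by rewrite GRing.oppr_eq0 GRing.oner_eq0.
  by split; rewrite ?sum2 ?GRing.subrr // in_mset2 !(eq_sym 0%R) GRing.oppr_eq0 GRing.oner_eq0.
by rewrite sum2 => /eqP; rewrite GRing.addrC GRing.addr_eq0 => /eqP ->.
Qed.

Lemma field_nullM (a : K) (s : {mset K}) : a != 0%R -> field_null s ->
  field_null (seq_mset [seq (a * x)%R | x <- s]).
Proof.
move=> a0 [s0 sum0]; split.
  rewrite (perm_mem (perm_eq_seq_mset _)); apply/mapP=> -[x xs] /esym/eqP.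
  by rewrite GRing.mulf_eq0 (negPf a0) /= => /eqP x0; rewrite x0 (negPf s0) in xs.
rewrite (perm_big _ (perm_eq_seq_mset _)) big_map -big_distrr /= sum0.
exact: GRing.mulr0.
Qed.

Lemma field_null0 : field_null (mset0 : {mset K}).
Proof. by split; rewrite ?in_mset0 // enum_mset0 big_nil. Qed.

HB.instance Definition _ := Choice.on (field_tract K).
HB.instance Definition _ :=
  isMonoid.Build (field_tract K) (@GRing.mulrA K) (@GRing.mul1r K) (@GRing.mulr1 K).
End FieldTract.

HB.instance Definition _ (K : fieldType) :=
  Monoid_isTract.Build (field_tract K) (@GRing.mulrC K) (@GRing.mul0r K)
    (@GRing.oner_neq0 K) (fun x x0 => ex_intro _ (x^-1)%R (GRing.mulVf x0))
    (fun s (ns : field_null s) => ns.1) (@field_null0 K) (@field_null_eps K)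
    (@field_nullM K).

Record matroid (T : finType) := Matroid {
  bases : {set {set T}};
  bases_neq0 : bases != set0;
  bases_exchange : forall B1 B2 x, B1 \in bases -> B2 \in bases ->
    x \in B1 :\: B2 ->
    exists2 y, y \in B2 :\: B1 & y |: (B1 :\ x) \in bases }.

Section Matroid.
Variables (T : finType) (M : matroid T).

Definition mrank : nat := \max_(B in bases M) #|B|.

Definition indep (BB : {set {set T}}) (I : {set T}) : bool :=
  [exists B in BB, I \subset B].

Definition dual_bases : {set {set T}} := [set ~: B | B in bases M].

Definition circuit (C : {set T}) : bool :=
  minset (fun I => ~~ indep (bases M) I) C.

Definition cocircuit (D : {set T}) : bool :=
  minset (fun I => ~~ indep dual_bases I) D.
End Matroid.

Section Vectors.
Variables (F : tractType) (n : nat).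
Implicit Types X Y : 'rV[F]_n.

Definition support X : {set 'I_n} := [set i | X ord0 i != tzero].

Definition tscale (c : F) X : 'rV[F]_n := map_mx (fun x => c * x) X.

Definition orthogonal X Y : Prop :=
  tnull (formal_sum [seq X ord0 i * Y ord0 i | i : 'I_n]).
End Vectors.

(* [signature S P]: the set S of vectors is closed under scaling by F^x, its
   elements have supports satisfying P, and every set satisfying P is the
   support of an element of S that is unique up to scaling by F^x. *)
Definition signature (F : tractType) (n : nat) (S : 'rV[F]_n -> Prop)
    (P : {set 'I_n} -> bool) : Prop :=
  [/\ forall c X, c != tzero -> S X -> S (tscale c X),
      forall X, S X -> P (support X),
      forall C, P C -> exists2 X, S X & support X = C &
      forall X Y, S X -> S Y -> support X = support Y ->
        exists2 c, c != tzero & Y = tscale c X].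

Record Fmatroid (F : tractType) (n : nat) := FMatroid {
  underlying : matroid 'I_n;
  Fcircuit : 'rV[F]_n -> Prop;
  Fcocircuit : 'rV[F]_n -> Prop;
  Fcircuit_sig : signature Fcircuit (circuit underlying);
  Fcocircuit_sig : signature Fcocircuit (cocircuit underlying);
  Fcircuit_orth : forall X Y, Fcircuit X -> Fcocircuit Y -> orthogonal X Y }.

Section Fmatroid.
Variables (F : tractType) (n : nat) (M : Fmatroid F n).

Definition Frank : nat := mrank (underlying M).

Definition Fvector (X : 'rV[F]_n) : Prop :=
  forall Y, Fcocircuit M Y -> orthogonal X Y.

Definition Fcovector (X : 'rV[F]_n) : Prop :=
  forall Y, Fcircuit M Y -> orthogonal X Y.
End Fmatroid.

Section TractTheory.
Variable F : tractType.
Implicit Types x y c : F.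

Lemma tM0 x : x * tzero = tzero.
Proof. by rewrite (tmulC x) tmul0. Qed.

Lemma tM_neq0 x y : x != tzero -> y != tzero -> x * y != tzero.
Proof.
move=> x0 y0; apply/eqP => xy0; have [x' x'x] := tmulV x0.
by move: y0; rewrite -[y]mul1g -x'x -mulgA xy0 tM0 eqxx.
Qed.

Lemma tM_eq0 x y : (x * y == tzero) = (x == tzero) || (y == tzero).
Proof.
case: (eqVneq x tzero) => [->|x0] /=; first by rewrite tmul0 eqxx.
case: (eqVneq y tzero) => [->|y0] /=; first by rewrite tM0 eqxx.
exact/negbTE/tM_neq0.
Qed.

Lemma tV x : x != tzero -> exists2 y, y != tzero & y * x = 1.
Proof.
move=> x0; have [y yx] := tmulV x0; exists y => //.
by apply: contraTneq isT => y0; move: (@tone_neq0 F); rewrite -yx y0 tmul0 eqxx.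
Qed.

Lemma support_scale n c (X : 'rV[F]_n) :
  c != tzero -> support (tscale c X) = support X.
Proof. by move=> c0; apply/setP => i; rewrite !inE mxE tM_eq0 (negPf c0). Qed.

Lemma tscaleA n c d (X : 'rV[F]_n) : tscale c (tscale d X) = tscale (c * d) X.
Proof. by apply/rowP => i; rewrite !mxE mulgA. Qed.
End TractTheory.

Section PushForward.
Variables (F' F : tractType) (phi : tract_hom F' F) (n : nat).

Lemma thomMr x y : phi (x * y) = phi x * phi y.
Proof.
case: (eqVneq x tzero) => [->|x0]; first by rewrite tmul0 thom0 tmul0.
case: (eqVneq y tzero) => [->|y0]; first by rewrite tM0 thom0 tM0.
exact: thomM.
Qed.

Lemma thom_eq0 x : (phi x == tzero) = (x == tzero).
Proof.
case: (eqVneq x tzero) => [->|x0]; first by rewrite thom0 eqxx.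
exact/negbTE/thom_neq0.
Qed.

Definition push_set (S : 'rV[F']_n -> Prop) (Y : 'rV[F]_n) : Prop :=
  exists c X, [/\ c != tzero, S X & Y = tscale c (map_mx phi X)].

Lemma support_map (X : 'rV[F']_n) : support (map_mx phi X) = support X.
Proof. by apply/setP => i; rewrite !inE mxE thom_eq0. Qed.

Lemma push_signature S P : signature S P -> signature (push_set S) P.
Proof.
move=> [Sc SP PS Su]; split.
- move=> d _ d0 [c [X [c0 SX ->]]]; exists (d * c), X.
  by rewrite tscaleA tM_neq0.
- by move=> _ [c [X [c0 SX ->]]]; rewrite support_scale // support_map; apply: SP.
- move=> C /PS[X SX <-]; exists (map_mx phi X); last exact: support_map.
  exists 1, X; split=> //; first exact: tone_neq0.
  by apply/rowP => i; rewrite !mxE mul1g.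
move=> _ _ [c [X [c0 SX ->]]] [d [Y [d0 SY ->]]].
rewrite !support_scale // !support_map => /(Su _ _ SX SY)[a a0 ->].
have [c' c'0 c'c] := tV c0.
exists (d * phi a * c'); first by rewrite !tM_neq0 // thom_neq0.
by apply/rowP => i; rewrite !mxE thomMr -!mulgA (mulgA c') c'c mul1g.
Qed.

Lemma push_orth S S' :
    (forall X Y, S X -> S' Y -> orthogonal X Y) ->
  forall X Y, push_set S X -> push_set S' Y -> orthogonal X Y.
Proof.
move=> SS' _ _ [c [X [c0 SX ->]]] [d [Y [d0 SY ->]]].
have cd0 := tM_neq0 c0 d0.
have := tnullM cd0 (thom_null phi (SS' _ _ SX SY)).
rewrite /orthogonal /formal_sum; congr (tnull _); apply/eq_seq_msetP.
apply: perm_trans (perm_map _ (perm_eq_seq_mset _)) _.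
apply: perm_trans (perm_map _ (perm_map _ (perm_eq_seq_mset _))) _.
rewrite !filter_map -!map_comp; apply/seq.permP => a; rewrite !count_map !count_filter.
apply: eq_count => i /=; rewrite !mxE !tM_eq0 !thom_eq0 (negPf c0) (negPf d0) /=.
congr (a _ && _); rewrite thomMr -!mulgA; congr (_ * _).
by rewrite !mulgA (tmulC d).
Qed.

Definition push_forward (M : Fmatroid F' n) : Fmatroid F n :=
  @FMatroid F n (underlying M) (push_set (Fcircuit M))
    (push_set (Fcocircuit M))
    (push_signature (Fcircuit_sig M)) (push_signature (Fcocircuit_sig M))
    (push_orth (@Fcircuit_orth _ _ M)).
End PushForward.

Definition epic (F' F : tractType) (phi : tract_hom F' F) : Prop :=
  forall n (M : Fmatroid F' n) (Y : 'rV[F]_n), Fvector (push_forward phi M) Y ->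
    exists2 X : 'rV[F']_n, Fvector M X & map_mx phi X = Y.

(* The least natural number satisfying P; [None] stands for +oo. *)
Definition min_nat (P : nat -> Prop) : option nat :=
  if pselect (exists r, `[< P r >]) is left exP then Some (ex_minn exP)
  else None.

Definition rmat (F : tractType) m n (A : 'M[F]_(m, n)) : option nat :=
  min_nat (fun r => exists M : Fmatroid F n,
    Frank M = r /\ forall i, Fcovector M (row i A)).

Section RanksOfHom.
Variables (F' F : tractType) (phi : tract_hom F' F) (m n : nat).
Variable A : 'M[F]_(m, n).

Definition rmat_preim : option nat :=
  min_nat (fun r => exists A' : 'M[F']_(m, n),
    map_mx phi A' = A /\ rmat A' = Some r).

Definition rmat_hom : option nat :=
  min_nat (fun r => exists M : Fmatroid F' n,
    Frank M = r /\ forall i, Fcovector (push_forward phi M) (row i A)).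
End RanksOfHom.

Definition mxrank_preim (K : fieldType) (F : tractType)
    (phi : tract_hom (field_tract K) F) m n (A : 'M[F]_(m, n)) : option nat :=
  min_nat (fun r => exists A' : 'M[K]_(m, n),
    map_mx phi A' = A /\ \rank A' = r).

(* Main.v *)
(* A lift A' of A of rank r has its rows in its row space, which is a K-matroid
   of rank r, and covectors push forward to covectors.  Conversely, if the rows
   of A are covectors of the push-forward of M, then, since push-forward
   commutes with duality and covectors of M are vectors of its dual, epicness
   lifts them to covectors of M; and a covector of M vanishing on a basis B
   vanishes, by orthogonality to the fundamental circuits of B, so that the
   lifted matrix has rank at most that of M. *)

Require Import Defs.
From mathcomp Require Import all_boot all_algebra.
From mathcomp Require Import boolp.
From mathcomp Require multiset.

Set Implicit Arguments.
Unset Strict Implicit.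
Unset Printing Implicit Defensive.

Import GRing.Theory.
Local Open Scope ring_scope.

(** * Least elements of predicates on the natural numbers *)

Lemma min_nat_Some (P : nat -> Prop) (r : nat) :
  P r -> (forall s, P s -> (r <= s)%N) -> min_nat P = Some r.
Proof.
move=> Pr r_min; rewrite /min_nat; case: pselect => [exP|[]]; last first.
  by exists r; apply/asboolP.
case: ex_minnP => k /asboolP Pk k_min; congr Some; apply/eqP.
by rewrite eqn_leq r_min // k_min //; apply/asboolP.
Qed.

(** Values of [Q] need only be bounded below by values of [P], since a lifted matrix may have
    smaller rank than the matroid used to lift it. The case where both minima are infinite is
    included. *)
Lemma min_nat_eq (P Q : nat -> Prop) :
    (forall r, P r -> Q r) ->
    (forall r, Q r -> exists2 s, P s & (s <= r)%N) ->
  min_nat P = min_nat Q.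
Proof.
move=> PQ QP; have [[s Ps]|noP] := pselect (exists s, P s); last first.
  rewrite /min_nat; case: pselect => [exP|_].
    by case: noP; have [r /asboolP Pr] := exP; exists r.
  case: pselect => // exQ; have [r /asboolP/QP[s Ps _]] := exQ.
  by case: noP; exists s.
have exP : exists s, `[< P s >] by exists s; apply/asboolP.
case: (ex_minnP exP) => k /asboolP Pk k_min.
have kP r : P r -> (k <= r)%N by move=> Pr; apply: k_min; apply/asboolP.
rewrite (min_nat_Some Pk kP) (min_nat_Some (PQ _ Pk)) // => r /QP[s' Ps' s'r].
exact: leq_trans (kP _ Ps') s'r.
Qed.

(** * Bases and duality of matroids *)

Lemma in_dual_bases (T : finType) (M : matroid T) (B : {set T}) :
  (B \in dual_bases M) = (~: B \in bases M).
Proof.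
apply/imsetP/idP => [[B' B'M ->]|BM]; first by rewrite setCK.
by exists (~: B); rewrite ?setCK.
Qed.

Section MatroidDuality.
Variables (T : finType) (M : matroid T).
Implicit Types (B : {set T}) (x y : T).

Lemma card_exchange B x y : x \in B -> y \notin B -> #|y |: (B :\ x)| = #|B|.
Proof.
by move=> xB yB; rewrite cardsU1 !inE (negPf yB) andbF (cardsD1 x B) xB.
Qed.

(** Induction on [#|B1 :\: B2|], which an exchange decreases. Once it is zero, an element of [B2]
    outside [B1] would have to be exchanged for an element of the empty set. *)
Lemma eq_card_bases B1 B2 :
  B1 \in bases M -> B2 \in bases M -> #|B1| = #|B2|.
Proof.
have [k] := ubnP #|B1 :\: B2|; elim: k B1 => // k IHk B1 leBk B1M B2M.
have [/eqP|[x xB]] := set_0Vmem (B1 :\: B2); last first.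
  have [y yB yM] := bases_exchange B1M B2M xB.
  move: (xB) (yB); rewrite !inE => /andP[xB2 xB1] /andP[yB1 yB2].
  rewrite -(card_exchange xB1 yB1); apply: IHk => //.
  rewrite (cardsD1 x) xB add1n ltnS in leBk; apply: leq_ltn_trans leBk.
  apply/subset_leq_card/subsetP => z; rewrite !inE.
  case/andP=> zB2 /orP[/eqP zy|/andP[-> ->]]; last by rewrite zB2.
  by rewrite zy yB2 in zB2.
move=> B120; congr #|pred_of_set _|; apply/eqP; rewrite eqEsubset -setD_eq0 B120 /=.
apply/subsetP => x xB2; apply/negPn/negP => xB1.
have xB : x \in B2 :\: B1 by rewrite inE xB1.
by have [y] := bases_exchange B2M B1M xB; rewrite (eqP B120) inE.
Qed.

Lemma card_base B : B \in bases M -> #|B| = mrank M.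
Proof.
move=> BM; apply/eqP; rewrite eqn_leq leq_bigmax_cond //=.
by apply/bigmax_leqP => B' B'M; rewrite (eq_card_bases B'M BM).
Qed.

(* Among the bases containing x and B1 :&: B2, one with the fewest elements
   outside B1 has x as its only element outside B1. *)
Lemma bases_coexchange B1 B2 x :
    B1 \in bases M -> B2 \in bases M -> x \in B2 :\: B1 ->
  exists2 y, y \in B1 :\: B2 & x |: (B1 :\ y) \in bases M.
Proof.
move=> B1M B2M; rewrite inE => /andP[xB1 xB2].
pose P B := [&& B \in bases M, x \in B & B1 :&: B2 \subset B].
have PB2 : P B2 by rewrite /P B2M xB2 subsetIr.
case: (arg_minnP (fun B => #|B :\: B1|) PB2) => B /and3P[BM xB sB] B_min.
have BD1 z : z \in B -> z \notin B1 -> z = x.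
  move=> zB zB1; apply/eqP/negPn/negP => zx.
  have zD : z \in B :\: B1 by rewrite inE zB1.
  have [y] := bases_exchange BM B1M zD; rewrite inE => /andP[yB yB1] yM.
  have /B_min : P (y |: (B :\ z)).
    rewrite /P yM !inE (eq_sym x z) zx xB orbT /=.
    apply/subsetP => w wI; rewrite !inE (subsetP sB) // andbT.
    rewrite (contraNneq _ zB1) ?orbT // => <-.
    by move: wI; rewrite inE => /andP[].
  apply/negP; rewrite -ltnNge [X in (_ < X)%N](cardsD1 z) zD ltnS.
  apply/subset_leq_card/subsetP => w; rewrite !inE.
  case/andP=> wB1 /orP[/eqP wy|/andP[-> ->]]; last by rewrite wB1.
  by rewrite wy yB1 in wB1.
have [/eqP|[y]] := set_0Vmem (B1 :\: B).
  rewrite setD_eq0 => sB1; have : B1 \proper B.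
    by apply/properP; split=> //; exists x.
  by move/proper_card; rewrite (eq_card_bases B1M BM) ltnn.
rewrite inE => /andP[yB yB1]; exists y.
  rewrite inE yB1 andbT; apply: contra yB => yB2.
  by apply: (subsetP sB); rewrite inE yB1.
suff -> : x |: (B1 :\ y) = B by [].
apply/esym/eqP; rewrite eqEcard card_exchange // (eq_card_bases B1M BM) leqnn andbT.
apply/subsetP => z zB; rewrite !inE; have [//|/= zx] := eqVneq z x.
rewrite (contraTneq _ zB) ?(contraNneq _ zx) //; last by move->.
apply/negPn/negP => /(BD1 _ zB) zx'; by rewrite zx' eqxx in zx.
Qed.

Lemma dual_bases_neq0 : dual_bases M != set0.
Proof.
have /set0Pn[B BM] := bases_neq0 M.
by apply/set0Pn; exists (~: B); rewrite in_dual_bases setCK.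
Qed.

(** Removing [x] from [B1] adds it to [~: B1], so this is [bases_coexchange] for the complements. *)
Lemma dual_bases_exchange B1 B2 x :
    B1 \in dual_bases M -> B2 \in dual_bases M -> x \in B1 :\: B2 ->
  exists2 y, y \in B2 :\: B1 & y |: (B1 :\ x) \in dual_bases M.
Proof.
rewrite !in_dual_bases => B1M B2M xB.
have xBC : x \in ~: B2 :\: ~: B1 by move: xB; rewrite !inE negbK andbC.
have [y yB yM] := bases_coexchange B1M B2M xBC; exists y.
  by move: yB; rewrite !inE negbK andbC.
rewrite in_dual_bases; suff <- : x |: (~: B1 :\ y) = ~: (y |: (B1 :\ x)) by [].
apply/setP => z; rewrite !inE negb_or negb_and negbK.
have [->|_] /= := eqVneq z x; last by [].
rewrite andbT; symmetry.
by rewrite (contraTneq _ yB) // => <-; move: xB; rewrite !inE => /andP[_ ->]; rewrite andbF.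
Qed.

Definition dual_matroid : matroid T := Matroid dual_bases_neq0 dual_bases_exchange.

Lemma dual_basesK : dual_bases dual_matroid = bases M.
Proof. by apply/setP => B; rewrite !in_dual_bases setCK. Qed.

(** [x |: B] is too large to be independent, and a dependent subset of it avoiding [x] would lie in
    [B]. *)
Lemma fundamental_circuit B x : B \in bases M -> x \notin B ->
  exists C, [/\ circuit M C, x \in C & C \subset x |: B].
Proof.
move=> BM xB; have : ~~ indep (bases M) (x |: B).
  apply/existsP => -[B' /andP[B'M /subset_leq_card]].
  by rewrite cardsU1 xB (eq_card_bases B'M BM) ltnn.
case/(@minset_exists _ (fun I => ~~ indep (bases M) I)) => C Cmin sC; exists C; split=> //.
apply: contraT => xC; have /minsetP[/existsP[]] := Cmin; exists B; rewrite BM /=.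
apply/subsetP => y yC; move/subsetP/(_ y yC): sC; rewrite !inE.
by case: eqVneq yC xC => // -> ->.
Qed.

End MatroidDuality.

(** * Duality of matroids over a tract *)

Section Duality.
Variables (F : tractType) (n : nat).

Lemma orthogonalC (X Y : 'rV[F]_n) : Defs.orthogonal X Y -> Defs.orthogonal Y X.
Proof.
rewrite /Defs.orthogonal; congr (tnull (formal_sum _)).
by apply: eq_map => i; rewrite tmulC.
Qed.

Variable M : Fmatroid F n.

Lemma dual_cocircuit_signature :
  signature (Fcircuit M) (cocircuit (dual_matroid (underlying M))).
Proof. by rewrite /cocircuit dual_basesK; apply: Fcircuit_sig. Qed.

(** The two sets of vectors are swapped unchanged, so that vectors of the dual are covectors of [M]
    by conversion. *)
Definition dual_Fmatroid : Fmatroid F n :=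
  @FMatroid F n (dual_matroid (underlying M)) (Fcocircuit M) (Fcircuit M)
    (Fcocircuit_sig M) dual_cocircuit_signature
    (fun X Y MX MY => orthogonalC (Fcircuit_orth MY MX)).

End Duality.

(** * Covectors and push-forward *)

Section TractHom.
Variables (F' F : tractType) (phi : tract_hom F' F) (n : nat).

(** [push_orth] holds for arbitrary sets of vectors, here for the singleton of [X]. *)
Lemma push_covector (M : Fmatroid F' n) (X : 'rV[F']_n) :
  Fcovector M X -> Fcovector (push_forward phi M) (map_mx phi X).
Proof.
move=> MX Y MY.
apply: (@push_orth _ _ phi n (fun Z => Z = X) (Fcircuit M)) => //.
  by move=> _ Z ->; apply: MX.
exists 1%g, X; split=> //; first exact: tone_neq0.
by apply/rowP => i; rewrite !mxE mul1g.
Qed.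

(** Epicness is applied to the dual of [M], whose pushed cocircuits are the pushed circuits of
    [M]. *)
Lemma epic_covector (M : Fmatroid F' n) (Y : 'rV[F]_n) : epic phi ->
    Fcovector (push_forward phi M) Y ->
  exists2 X : 'rV[F']_n, Fcovector M X & map_mx phi X = Y.
Proof. by move=> phi_epic; apply: (phi_epic n (dual_Fmatroid M)). Qed.

End TractHom.

(** * The dot product and orthogonality over a field *)

Section DotProduct.
Variables (K : fieldType) (n : nat).
Implicit Types u v w : 'rV[K]_n.

Definition dotr u v : K := (u *m v^T) 0 0.

Lemma dotrE u v : dotr u v = \sum_i u 0 i * v 0 i.
Proof. by rewrite /dotr mxE; apply: eq_bigr => i _; rewrite mxE. Qed.

Lemma dotrC u v : dotr u v = dotr v u.
Proof. by rewrite !dotrE; apply: eq_bigr => i _; rewrite mulrC. Qed.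

Lemma dotr0 u : dotr u 0 = 0.
Proof. by rewrite /dotr trmx0 mulmx0 mxE. Qed.

Lemma dotrDZr a u v w : dotr u (a *: v + w) = a * dotr u v + dotr u w.
Proof. by rewrite /dotr linearP /= mulmxDr -scalemxAr !mxE. Qed.

Lemma dotr_supp1 i u v : (forall j, j != i -> u 0 j * v 0 j = 0) ->
  dotr u v = u 0 i * v 0 i.
Proof. by move=> uv0; rewrite dotrE (bigD1 i) //= big1 ?addr0. Qed.

(** Discarding zero terms leaves the sum unchanged and ensures that the multiset avoids [0], as
    [field_null] demands. *)
Lemma orthogonal_fieldP u v :
  @Defs.orthogonal (field_tract K) n u v <-> dotr u v = 0.
Proof.
rewrite /Defs.orthogonal /formal_sum; set s := [seq x <- _ | _].
have sE : \sum_(x <- multiset.enum_mset (multiset.seq_mset s)) (x : K) = dotr u v.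
  rewrite (perm_big _ (multiset.perm_eq_seq_mset _)) big_filter big_mkcond /=.
  rewrite big_map big_enum dotrE; apply: eq_bigr => i _.
  by case: ifP => // /negbFE/eqP.
split=> [[_]|uv0]; first by rewrite sE.
split; last by rewrite sE.
rewrite (perm_mem (multiset.perm_eq_seq_mset _)) mem_filter.
by rewrite (_ : 0 != _ = false) //; apply/negbF/eqP.
Qed.

Lemma in_support_field u i : (i \in @Defs.support (field_tract K) n u) = (u 0 i != 0).
Proof. by rewrite inE. Qed.

End DotProduct.

(** * The matroid of a linear subspace *)

Section Subspace.
Variables (K : fieldType) (n : nat).
Implicit Types (U : 'rV[K]_n -> Prop) (u v w : 'rV[K]_n) (B C I : {set 'I_n}).

Definition subspace U : Prop :=
  U 0 /\ forall a u v, U u -> U v -> U (a *: u + v).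

Definition perp U : 'rV[K]_n -> Prop := fun w => forall u, U u -> dotr u w = 0.

Definition zero_on B u : Prop := {in B, forall i, u 0 i = 0}.

Definition unit_on B i u : Prop := {in B, forall j, u 0 j = (j == i)%:R}.

(* Equivalently, the restriction map U -> K^B is bijective; this form needs no
   dimension count. *)
Definition is_base U B : Prop :=
  (forall u, U u -> zero_on B u -> u = 0) /\
  {in B, forall i, exists2 v, U v & unit_on B i v}.

Definition subspace_bases U : {set {set 'I_n}} := [set B | `[< is_base U B >]].

Lemma subspace_basesP U B : reflect (is_base U B) (B \in subspace_bases U).
Proof. by rewrite inE; apply: asboolP. Qed.

Lemma subspaceZ U a u : subspace U -> U u -> U (a *: u).
Proof. by case=> U0 UD Uu; rewrite -[_ *: _]addr0; apply: UD. Qed.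

Lemma subspaceB U a u v : subspace U -> U u -> U v -> U (u - a *: v).
Proof. by case=> U0 UD Uu Uv; rewrite addrC -scaleNr; apply: UD. Qed.

Lemma subspace_sum U (I : finType) (P : pred I) (a : I -> K) (v : I -> 'rV[K]_n) :
  subspace U -> (forall i, P i -> U (v i)) -> U (\sum_(i | P i) a i *: v i).
Proof.
move=> [U0 UD] Uv; elim/big_rec: _ => // i x Pi Ux.
by apply: UD => //; apply: Uv.
Qed.

Lemma subspace_perp U : subspace (perp U).
Proof.
split=> [u _|a v w Uv Uw u Uu]; first exact: dotr0.
by rewrite dotrDZr Uv // Uw // mulr0 addr0.
Qed.

(** A minimal [B] on which restriction is injective works: for [i] in [B], injectivity fails on
    [B :\ i], and a nonzero vector vanishing there can be scaled to be [1] at [i]. *)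
Lemma exists_base U : subspace U -> exists B, is_base U B.
Proof.
move=> sU.
pose P B := `[< forall u, U u -> zero_on B u -> u = 0 >].
have /(@minset_exists _ P)[B /minsetP[/asboolP PB B_min] _] : P setT.
  by apply/asboolP => u _ u0; apply/rowP => i; rewrite u0 ?mxE ?inE.
exists B; split=> // i iB.
have [u Uu [u0 un0]] : exists2 u, U u & zero_on (B :\ i) u /\ u <> 0.
  apply: contrapT => no_u; have := B_min (B :\ i).
  move/(_ _ (subD1set _ _))/(congr1 (fun C => i \in C)); rewrite iB !inE eqxx /=.
  suff PBi : P (B :\ i) by move/(_ PBi).
  apply/asboolP => u Uu u0; apply: contrapT => un0; by apply: no_u; exists u.
have ui0 : u 0 i != 0.
  apply/eqP => ui0; apply: un0; apply: PB => // j jB.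
  by have [->//|ji] := eqVneq j i; apply: u0; rewrite !inE ji.
exists ((u 0 i)^-1 *: u); first exact: subspaceZ.
move=> j jB; rewrite mxE; have [->|ji] := eqVneq j i; first by rewrite mulVf.
by rewrite (u0 j) ?mulr0 // !inE ji.
Qed.

(** A pivot of Gaussian elimination at the nonzero entry [v 0 x]. *)
Lemma base_swap U B x y v : subspace U -> is_base U B -> y \in B ->
    U v -> unit_on B y v -> v 0 x != 0 ->
  is_base U (x |: (B :\ y)).
Proof.
move=> sU [B0 B1] yB Uv v1 vx0.
have vB j : j \in B :\ y -> v 0 j = 0.
  by rewrite !inE => /andP[/negPf jy jB]; rewrite v1 // jy.
split=> [u Uu u0|i].
  have uE : u = u 0 y *: v.
    apply/eqP; rewrite -subr_eq0; apply/eqP/B0; first exact: subspaceB.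
    move=> j jB; rewrite !mxE v1 //; have [->|jy] := eqVneq j y.
      by rewrite mulr1 subrr.
    by rewrite mulr0 subr0 u0 // !inE jy jB orbT.
  have /eqP : u 0 x = 0 by rewrite u0 // !inE eqxx.
  by rewrite {1}uE mxE mulf_eq0 (negPf vx0) orbF => /eqP uy0; rewrite uE uy0 scale0r.
rewrite 2!inE; case: eqVneq => [-> _|ix /= iB].
  exists ((v 0 x)^-1 *: v); first exact: subspaceZ.
  move=> j; rewrite mxE 2!inE; case: eqVneq => [->|jx /= jB]; first by rewrite mulVf.
  by rewrite (vB j) // mulr0.
have [w Uw w1] := B1 i (subsetP (subD1set _ _) _ iB).
(* The coefficient clears coordinate [x]; coordinates in [B :\ y] are kept because [v] vanishes
   there. *)
exists (w - (w 0 x / v 0 x) *: v); first exact: subspaceB.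
move=> j; rewrite !mxE 2!inE; case: eqVneq => [->|jx /= jB].
  by rewrite divfK // subrr eq_sym (negPf ix).
by rewrite (vB j) // mulr0 subr0 w1 // (subsetP (subD1set _ _) _ jB).
Qed.

Lemma base_frame U B : is_base U B ->
  exists v : 'I_n -> 'rV[K]_n, {in B, forall i, U (v i) /\ unit_on B i (v i)}.
Proof.
move=> [_ B1]; have [i|v Bv] := @choice _ _ (fun i v => i \in B -> U v /\ unit_on B i v).
  have [/B1[v Uv v1]|iB] := boolP (i \in B); first by exists v.
  (* Outside [B] the value is arbitrary. *)
  by exists 0.
by exists v.
Qed.

Lemma frame_sum U B (v : 'I_n -> 'rV[K]_n) (c : 'I_n -> K) : subspace U ->
    {in B, forall i, U (v i) /\ unit_on B i (v i)} ->
  U (\sum_(i in B) c i *: v i) /\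
  {in B, forall j, (\sum_(i in B) c i *: v i) 0 j = c j}.
Proof.
move=> sU Bv; split=> [|j jB]; first by apply: subspace_sum => // i /Bv[].
rewrite summxE (bigD1 j) //= big1 => [|i /andP[iB ij]].
  by have [_ /(_ j jB)] := Bv j jB; rewrite mxE eqxx addr0 => ->; rewrite mulr1.
by have [_ /(_ j jB)] := Bv i iB; rewrite mxE eq_sym (negPf ij) => ->; rewrite mulr0.
Qed.

(* The vector of perp U supported on the fundamental circuit of x. *)
Lemma fundamental_vector U B x : subspace U -> is_base U B -> x \notin B ->
  exists w, [/\ perp U w, w 0 x = 1 &
    forall j, j != x -> w 0 j != 0 -> j \in B /\ is_base U (x |: (B :\ j))].
Proof.
move=> sU BU xB; have [B0 B1] := BU; have [v Bv] := base_frame BU.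
(* Expanding [u] in the frame gives [u 0 x] as the sum of the [u 0 j * v j 0 x]; the minus sign
   makes the pairing with [w] cancel. *)
pose w : 'rV[K]_n := \row_j (if j \in B then - v j 0 x else (j == x)%:R).
exists w; split=> [u Uu||j jx].
- have uE : u = \sum_(i in B) u 0 i *: v i.
    have [Us us] := frame_sum (fun i => u 0 i) sU Bv.
    apply/eqP; rewrite -subr_eq0 -[X in u - X]scale1r; apply/eqP/B0.
      exact: subspaceB.
    by move=> j jB; rewrite !mxE mul1r us // subrr.
  rewrite dotrE (bigID (mem B)) /= [X in _ + X](bigD1 x) //= [X in _ + (_ + X)]big1.
    rewrite !mxE (negPf xB) eqxx mulr1 addr0 [in X in _ + X]uE summxE -big_split /=.
    by apply: big1 => i iB; rewrite !mxE iB mulrN addNr.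
  by move=> i /andP[/negPf iB /negPf ix]; rewrite mxE iB ix mulr0.
- by rewrite mxE (negPf xB) eqxx.
rewrite mxE (negPf jx); case: ifP => [jB|_]; last by rewrite eqxx.
rewrite oppr_eq0 => vjx; have [Uv v1] := Bv j jB.
by split=> //; apply: base_swap v1 vjx.
Qed.

(** Pairing with the unit vectors of [B] reads off the entries of a vector vanishing outside [B];
    the unit vectors on [~: B] are the fundamental vectors. *)
Lemma base_perp U B : subspace U -> is_base U B -> is_base (perp U) (~: B).
Proof.
move=> sU BU; split=> [w Uw w0|x].
  apply/rowP => i; rewrite mxE; have [iB|iB] := boolP (i \in B); last first.
    by rewrite w0 ?inE.
  have [v Uv v1] := BU.2 i iB; have := Uw v Uv; rewrite (@dotr_supp1 _ _ i).
    by rewrite v1 // eqxx mul1r.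
  move=> j ji; have [jB|jB] := boolP (j \in B); first by rewrite v1 // (negPf ji) mul0r.
  by rewrite w0 ?mulr0 ?inE.
rewrite inE => xB; have [w [Uw wx wj]] := fundamental_vector sU BU xB.
exists w => // j; rewrite inE => jB; have [->|jx] := eqVneq j x; first by [].
by apply/eqP/negPn/negP => /(wj j jx)[jB']; rewrite jB' in jB.
Qed.

(** Complementing twice, a base [B] of [U] is also a base of the double perp. Thus [u] equals the
    element of [U] that agrees with it on [B]. *)
Lemma perpK U u : subspace U -> perp (perp U) u -> U u.
Proof.
move=> sU Uu; have [B BU] := exists_base sU.
have BUU : is_base (perp (perp U)) B.
  by rewrite -[B]setCK; apply: base_perp (subspace_perp _) (base_perp sU BU).
have [v Bv] := base_frame BU; have [Us us] := frame_sum (fun i => u 0 i) sU Bv.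
suff -> : u = \sum_(i in B) u 0 i *: v i by [].
apply/eqP; rewrite -subr_eq0 -[X in u - X]scale1r; apply/eqP/BUU.1.
  apply: (@subspaceB (perp (perp U))) => //; first exact: subspace_perp.
  by move=> w Uw; rewrite dotrC Uw.
by move=> j jB; rewrite !mxE mul1r us // subrr.
Qed.

Lemma subspace_bases_perp U B : subspace U ->
  (~: B \in subspace_bases U) = (B \in subspace_bases (perp U)).
Proof.
move=> sU; apply/subspace_basesP/subspace_basesP => [|BU].
  by move/(base_perp sU); rewrite setCK.
have [C0 C1] := base_perp (subspace_perp U) BU; split=> [u Uu|i /C1[v /(perpK sU)]].
  by apply: C0 => w Uw; rewrite dotrC Uw.
by exists v.
Qed.

Lemma subspace_bases_neq0 U : subspace U -> subspace_bases U != set0.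
Proof. by case/exists_base=> B BU; apply/set0Pn; exists B; apply/subspace_basesP. Qed.

Lemma subspace_bases_exchange U : subspace U -> forall B1 B2 x,
    B1 \in subspace_bases U -> B2 \in subspace_bases U -> x \in B1 :\: B2 ->
  exists2 y, y \in B2 :\: B1 & y |: (B1 :\ x) \in subspace_bases U.
Proof.
move=> sU B1 B2 x /subspace_basesP B1U /subspace_basesP B2U.
rewrite inE => /andP[xB2 xB1]; have [v Uv v1] := B1U.2 x xB1.
(* As [v] is nonzero, it cannot vanish on [B2]. *)
have [y yB2 vy] : exists2 y, y \in B2 & v 0 y != 0.
  apply: contrapT => no_y; have v0 : v = 0.
    apply: B2U.1 => // y yB2; apply/eqP/negPn/negP => vy; apply: no_y.
    by exists y.
  by have /eqP := v1 x xB1; rewrite v0 mxE eqxx eq_sym oner_eq0.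
exists y; last by apply/subspace_basesP; apply: base_swap v1 vy.
rewrite inE yB2 andbT; apply: contra vy => yB1; rewrite v1 //.
rewrite (_ : (y == x) = false) ?eqxx //; by apply: contraNF xB2 => /eqP <-.
Qed.

Definition subspace_matroid U (sU : subspace U) : matroid 'I_n :=
  Matroid (subspace_bases_neq0 sU) (subspace_bases_exchange sU).

Lemma dual_bases_subspace U (sU : subspace U) :
  dual_bases (subspace_matroid sU) = subspace_bases (perp U).
Proof. by apply/setP => B; rewrite in_dual_bases /= subspace_bases_perp. Qed.

(** [I] extends to a base, whose complement is a base of [perp U] on which [w] vanishes. *)
Lemma indep_perp0 U I w : subspace U -> indep (subspace_bases U) I ->
  perp U w -> zero_on (~: I) w -> w = 0.
Proof.
move=> sU /existsP[B /andP[/subspace_basesP BU sIB]] Uw w0.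
apply: (base_perp sU BU).1 => // i; rewrite inE => iB; apply: w0.
by rewrite inE; apply: contra iB; apply: (subsetP sIB).
Qed.

(** Convertible to [circuit (subspace_matroid sU)], but free of the proof [sU]; for [perp U] it
    describes the cocircuits. *)
Definition subspace_circuit U C : bool :=
  minset (fun I => ~~ indep (subspace_bases U) I) C.

Lemma proper_circuit_indep U C I :
  subspace_circuit U C -> I \proper C -> indep (subspace_bases U) I.
Proof.
move=> /minsetP[_ C_min] /andP[sIC nsCI]; apply: contraNT nsCI => /C_min -> //.
Qed.

Lemma circuit_neq0 U C : subspace U -> subspace_circuit U C -> exists x, x \in C.
Proof.
move=> sU /minsetP[Cdep _]; apply/set0Pn; apply: contraNneq Cdep => ->.
have /set0Pn[B BU] := subspace_bases_neq0 sU.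
by apply/existsP; exists B; rewrite BU sub0set.
Qed.

(** Extend [C :\ x] to a base [B] and take the fundamental vector of [x]. If [j] in its support were
    outside [C], swapping [j] for [x] would give a base containing [C]. The support is not a proper
    subset of [C], since such subsets are independent. *)
Lemma circuit_vector U C : subspace U -> subspace_circuit U C ->
  exists2 w, perp U w & @Defs.support (field_tract K) n w = C.
Proof.
move=> sU Ccirc; have [x xC] := circuit_neq0 sU Ccirc.
have /existsP[B /andP[BU sCB]] :=
  proper_circuit_indep Ccirc (properD1 xC).
have /subspace_basesP BU' := BU.
have /minsetP[Cdep _] := Ccirc.
have no_base B' : is_base U B' -> ~~ (C \subset B').
  move=> B'U; apply: contra Cdep => sCB'.
  by apply/existsP; exists B'; rewrite sCB' andbT; apply/subspace_basesP.
have xB : x \notin B.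
  apply: contra (no_base B BU') => xB; apply/subsetP => y yC.
  by have [->//|yx] := eqVneq y x; apply: (subsetP sCB); rewrite !inE yx.
have [w [Uw wx w_supp]] := fundamental_vector sU BU' xB.
have sC : @Defs.support (field_tract K) n w \subset C.
  apply/subsetP => j; rewrite in_support_field => wj.
  have [->//|jx] := eqVneq j x; have [jB /no_base] := w_supp j jx wj.
  apply: contraR => jC; apply/subsetP => y yC; rewrite !inE.
  have [//|yx] /= := eqVneq y x; rewrite (contraNneq _ jC) => [|<- //].
  by apply: (subsetP sCB); rewrite !inE yx.
exists w => //; apply/eqP; have := sC; rewrite subEproper => /orP[//|propC].
have w0 : w = 0.
  apply: indep_perp0 (proper_circuit_indep Ccirc propC) Uw _ => // j.
  by rewrite inE in_support_field negbK => /eqP.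
by have := oner_neq0 K; rewrite -wx w0 mxE eqxx.
Qed.

(** Circuits are taken in [perp U] so that the elements of [U] become covectors. *)
Definition circuit_vectors U w : Prop :=
  perp U w /\ subspace_circuit U (@Defs.support (field_tract K) n w).

Lemma circuit_signature U : subspace U ->
  @signature (field_tract K) n (circuit_vectors U) (subspace_circuit U).
Proof.
move=> sU; split=> [c X c0 [UX cX]|X []//|C cC|X Y [UX cX] [UY _] XY].
- split; last by rewrite support_scale.
  have -> : tscale c X = c *: (X : 'rV[K]_n) by apply/rowP => i; rewrite !mxE.
  exact: subspaceZ (subspace_perp U) UX.
- by have [w Uw wC] := circuit_vector sU cC; exists w; rewrite // /circuit_vectors wC.
have [i iX] := circuit_neq0 sU cX.
have Xi : (X : 'rV[K]_n) 0 i != 0 by rewrite -in_support_field.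
have Yi : (Y : 'rV[K]_n) 0 i != 0 by rewrite -in_support_field -XY.
(* This scalar cancels coordinate [i], leaving [Y - c *: X] supported on a circuit minus a point,
   which is independent. *)
pose c : K := (Y : 'rV[K]_n) 0 i / (X : 'rV[K]_n) 0 i.
exists c; first by rewrite mulf_neq0 ?invr_eq0.
suff YX0 : (Y : 'rV[K]_n) - c *: (X : 'rV[K]_n) = 0.
  by move/eqP: YX0; rewrite subr_eq0 => /eqP ->; apply/rowP => j; rewrite !mxE.
apply: indep_perp0 (proper_circuit_indep cX (properD1 iX)) _ _ => //.
  exact: subspaceB (subspace_perp U) UY UX.
move=> j; rewrite !inE negb_and negbK => /orP[/eqP ->|].
  by rewrite !mxE divfK // subrr.
rewrite negbK => /eqP Xj; have /eqP Yj : (Y : 'rV[K]_n) 0 j == 0.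
  by rewrite -[_ == _]negbK -in_support_field -XY inE Xj eqxx.
by rewrite !mxE Yj Xj mulr0 subrr.
Qed.

Section SubspaceFmatroid.
Variables (U : 'rV[K]_n -> Prop) (sU : subspace U).

Lemma cocircuit_signature :
  @signature (field_tract K) n (circuit_vectors (perp U))
    (cocircuit (subspace_matroid sU)).
Proof.
rewrite /cocircuit dual_bases_subspace.
exact: circuit_signature (subspace_perp U).
Qed.

Lemma circuit_vectors_orth X Y :
  circuit_vectors U X -> circuit_vectors (perp U) Y ->
  @Defs.orthogonal (field_tract K) n X Y.
Proof. by move=> [UX _] [UY _]; apply/orthogonal_fieldP; apply: UY. Qed.

Definition subspace_Fmatroid : Fmatroid (field_tract K) n :=
  @FMatroid (field_tract K) n (subspace_matroid sU) (circuit_vectors U)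
    (circuit_vectors (perp U)) (circuit_signature sU) cocircuit_signature
    circuit_vectors_orth.

Lemma subspace_Fcovector X : U X -> Fcovector subspace_Fmatroid X.
Proof. by move=> UX Y [UY _]; apply/orthogonal_fieldP; apply: UY. Qed.

End SubspaceFmatroid.

End Subspace.

(** * Matrix rank and matroidal rank over a field *)

Section MatrixRank.
Variables (K : fieldType) (m n : nat) (A : 'M[K]_(m, n)).

Lemma subspace_rows : subspace (fun u => (u <= A)%MS).
Proof.
split=> [|a u v uA vA]; first exact: sub0mx.
by rewrite addmx_sub // scalemx_sub.
Qed.

(** The unit vectors of [B] form a matrix [G] in the row space of [A] whose columns in [B] are the
    identity. *)
Lemma card_base_rows B : is_base (fun u => (u <= A)%MS) B -> (#|B| <= \rank A)%N.
Proof.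
case/base_frame=> v Bv; pose G := \matrix_(k < #|B|) v (enum_val k).
have sGA : (G <= A)%MS.
  by apply/row_subP => k; rewrite rowK; have [] := Bv _ (enum_valP k).
apply: leq_trans (mxrankS sGA); have G1 : colsub (@enum_val _ (mem B)) G = 1%:M.
  apply/matrixP => k l; rewrite !mxE.
  have [_ ->] := Bv _ (enum_valP k); last exact: enum_valP.
  by rewrite (inj_eq enum_val_inj) eq_sym.
by rewrite -[X in (X <= _)%N](mxrank1 K) -G1 -{1}[G]mulmx1 -mulmx_colsub mxrankM_maxl.
Qed.

Lemma mxrank_le_Frank (M : Fmatroid (field_tract K) n) :
  (forall i, Fcovector M (row i A)) -> (\rank A <= Frank M)%N.
Proof.
move=> covA; have /set0Pn[B BM] := bases_neq0 (underlying M).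
rewrite /Frank -(card_base BM); pose C := colsub (@enum_val _ (mem B)) A.
apply: leq_trans (rank_leq_col C).
(* [A] and [C] have the same number of rows, so inclusion of left kernels reverses the inequality of
   ranks. *)
suff: (kermx C <= kermx A)%MS.
  move/mxrankS; rewrite !mxrank_ker leq_sub2lE ?rank_leq_row //.
apply/rV_subP => u /sub_kermxP uC; apply/sub_kermxP/rowP => x; rewrite [RHS]mxE.
have zB j : j \in B -> (u *m A) 0 j = 0.
  move=> jB; have /rowP/(_ (enum_rank_in jB j)) := uC.
  by rewrite mulmx_colsub mxE [RHS]mxE enum_rankK_in.
have [/zB //|xB] := boolP (x \in B).
have [D [cD xD sD]] := fundamental_circuit BM xB.
have [_ _ /(_ D cD)[X MX XD] _] := Fcircuit_sig M.
have : dotr (u *m A) X = 0.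
  rewrite /dotr -mulmxA (_ : A *m _ = 0) ?mulmx0 ?mxE //.
  apply/colP => i; rewrite [RHS]mxE; have /orthogonal_fieldP := covA i X MX.
  by rewrite /dotr -row_mul mxE.
(* Only the term at [x] survives: [u *m A] vanishes on [B], and [X] vanishes outside [x |: B]. *)
rewrite (@dotr_supp1 _ _ x) => [/eqP|j jx].
  rewrite mulf_eq0 => /orP[/eqP //|]; rewrite -[_ == _]negbK -in_support_field.
  by rewrite XD xD.
have [/zB ->|jB] := boolP (j \in B); first by rewrite mul0r.
have /eqP -> : (X : 'rV[K]_n) 0 j == 0; last by rewrite mulr0.
rewrite -[_ == _]negbK -in_support_field XD; apply/negP => /(subsetP sD).
by rewrite !inE (negPf jx) (negPf jB).
Qed.

(** One inequality of ranks is [card_base_rows]; the other is the general bound [mxrank_le_Frank]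
    for this matroid. *)
Lemma Fmatroid_of_rows : exists M : Fmatroid (field_tract K) n,
  Frank M = \rank A /\ forall i, Fcovector M (row i A).
Proof.
pose M := subspace_Fmatroid subspace_rows; exists M.
have covA i : Fcovector M (row i A) by apply/subspace_Fcovector/row_sub.
split=> //; apply/eqP; rewrite eqn_leq mxrank_le_Frank // andbT.
have /set0Pn[B BM] := bases_neq0 (underlying M).
by rewrite /Frank -(card_base BM); apply/card_base_rows/subspace_basesP.
Qed.

Lemma rmat_field : @rmat (field_tract K) m n A = Some (\rank A).
Proof.
apply: min_nat_Some; first exact: Fmatroid_of_rows.
by move=> _ [M [<-]]; apply: mxrank_le_Frank.
Qed.

End MatrixRank.

Theorem theorem4p9 (K : fieldType) (F : tractType)
    (phi : tract_hom (field_tract K) F) (phi_epic : epic phi)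
    (m n : nat) (A : 'M[F]_(m, n)) :
  rmat_preim phi A = rmat_hom phi A /\ mxrank_preim phi A = rmat_hom phi A.
Proof.
have eq_preim : rmat_preim phi A = mxrank_preim phi A.
  congr min_nat; apply/funext => r; apply/propext.
  split=> -[A' [AA' rA']]; exists A'; move: rA'; rewrite rmat_field.
    by case.
  by move->.
rewrite eq_preim; suff: mxrank_preim phi A = rmat_hom phi A by [].
apply: min_nat_eq => [r [A' [<- <-]]|r [M [<- covA]]].
  have [M [MA' covA']] := Fmatroid_of_rows A'; exists M; split=> // i.
  by rewrite -map_row; apply: push_covector.
(* Epicness lifts one vector at a time; the lifts of the rows are chosen independently, all as
   covectors of the same [M]. *)
have [i|X XP] := @choice _ _ (fun i (X : 'rV[K]_n) =>
    Fcovector M X /\ map_mx phi X = row i A).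
  by have [X] := epic_covector phi_epic (covA i); exists X.
pose A' := \matrix_i X i.
exists (\rank A'); last by apply: mxrank_le_Frank => i; rewrite rowK; case: (XP i).
exists A'; split=> //; apply/row_matrixP => i.
by rewrite -map_row rowK; case: (XP i).
Qed.
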